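(* Let $\alpha,\beta$ be positive real numbers and let $(\{a_i\}_{i\ge 0},\{b_i\}_{i\ge 0})$ be an ordered pair of non-negative integer sequences. Then $(\{a_i\}_{i\ge 0},\{b_i\}_{i\ge 0})$ is a proper BCF representation of $(\alpha,\beta)$ if and only if it is an appropriate BCF representation of $(\alpha,\beta)$.
   Context: Fibonacci Tree sum: the ordered pair of real numbers $[\{a_0,\ldots,a_{n-1},x\},\{b_0,\ldots,b_{n-1},y\}]$, for $x,y$ positive reals, is defined recursively by $[\{x\},\{y\}]=(x,y)$ and, for $n\ge 1$, $[\{a_0,\ldots,a_{n-1},x\},\{b_0,\ldots,b_{n-1},y\}]=[\{a_0,\ldots,a_{n-2},a_{n-1}+y/x\},\{b_0,\ldots,b_{n-2},b_{n-1}+1/x\}]$. Proper BCF representation of $(\alpha,\beta)$: for every $n\ge 0$ there exist positive reals $\alpha_n,\beta_n$ such that $(\alpha,\beta)=[\{a_0,\ldots,a_{n-1},\alpha_n\},\{b_0,\ldots,b_{n-1},\beta_n\}]$, and $\alpha_n>1$ and $\alpha_n>\beta_n$ for all $n\ge 1$. Appropriate BCF representation of $(\alpha,\beta)$: for every $n\ge 0$ there exist positive reals $\alpha_n,\beta_n$ such that $(\alpha,\beta)=[\{a_0,\ldots,a_{n-1},\alpha_n\},\{b_0,\ldots,b_{n-1},\beta_n\}]$, and $\lfloor\alpha_n\rfloor=a_n$ and $\lfloor\beta_n\rfloor=b_n$. *)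

(* Defs.v *)
From mathcomp Require Import all_boot all_order all_algebra.
From mathcomp Require Import reals.

Set Implicit Arguments.
Unset Strict Implicit.
Unset Printing Implicit Defensive.

Import Order.TTheory GRing.Theory Num.Theory.
Local Open Scope ring_scope.

(* [fib_tree_sum a b n x y] is [{a_0,...,a_(n-1),x},{b_0,...,b_(n-1),y}].  Only
   the first [n] terms of [a] and [b] are used.  It is meant for [0 < x] and
   [0 < y]; positivity of the last entries is then preserved by the recursion,
   so the value of [x^-1] at [x = 0] plays no role. *)
Fixpoint fib_tree_sum (R : realType) (a b : nat -> nat) (n : nat) (x y : R) :
    R * R :=
  if n is m.+1
  then fib_tree_sum a b m ((a m)%:R + y / x) ((b m)%:R + 1 / x)
  else (x, y).

Definition proper_BCF (R : realType) (a b : nat -> nat) (alpha beta : R) :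
    Prop :=
  forall n : nat, exists alpha_n beta_n : R,
    [/\ 0 < alpha_n, 0 < beta_n,
        (alpha, beta) = fib_tree_sum a b n alpha_n beta_n
      & (1 <= n)%N -> 1 < alpha_n /\ beta_n < alpha_n].

Definition appropriate_BCF (R : realType) (a b : nat -> nat) (alpha beta : R) :
    Prop :=
  forall n : nat, exists alpha_n beta_n : R,
    [/\ 0 < alpha_n, 0 < beta_n,
        (alpha, beta) = fib_tree_sum a b n alpha_n beta_n
      & Num.floor alpha_n = (a n)%:Z /\ Num.floor beta_n = (b n)%:Z].

(* Main.v *)
Require Import Defs.
From mathcomp Require Import all_boot all_order all_algebra.
From mathcomp Require Import reals.

Set Implicit Arguments.
Unset Strict Implicit.
Unset Printing Implicit Defensive.

Import Order.TTheory GRing.Theory Num.Theory.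
Local Open Scope ring_scope.

(* The tails are uniquely determined and satisfy
   alpha_n = a_n + beta_(n+1) / alpha_(n+1) and beta_n = b_n + 1 / alpha_(n+1),
   so the floor conditions at n say exactly that both positive fractions are
   less than 1, which are the proper conditions at n+1. *)

(** One step of the recursion is injective on positive pairs: the second entry determines [x], and
    then the first determines [y]. *)
Lemma fib_tree_sum_inj (R : realType) (a b : nat -> nat) (n : nat)
    (x y x' y' : R) :
  0 < x -> 0 < y -> 0 < x' -> 0 < y' ->
  fib_tree_sum a b n x y = fib_tree_sum a b n x' y' -> x = x' /\ y = y'.
Proof.
elim: n x y x' y' => [|n IHn] x y x' y' x0 y0 x'0 y'0 /=; first by case.
have pos (u v : R) k : 0 < u -> 0 < v -> 0 < k%:R + u / v.
  by move=> u0 v0; rewrite ltr_wpDl ?divr_gt0.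
case/IHn; rewrite ?pos // => /addrI yx /addrI; rewrite !div1r => /invr_inj xx'.
by move: yx; rewrite xx' => /(divIf (lt0r_neq0 x'0)).
Qed.

Lemma floor_natD_eq (R : realType) (k : nat) (t : R) :
  0 < t -> Num.floor (k%:R + t) = k%:Z <-> t < 1.
Proof.
move=> t0; split=> [fl|t1].
  have := floorD1_gt (k%:R + t).
  by rewrite fl intrD ltrD2l.
by apply: floor_def; rewrite intrD ltrD2l t1 lerDl ltW.
Qed.

Lemma fib_tree_step_floor (R : realType) (k l : nat) (x y : R) :
  0 < x -> 0 < y ->
  Num.floor (k%:R + y / x) = k%:Z /\ Num.floor (l%:R + 1 / x) = l%:Z <->
  1 < x /\ y < x.
Proof.
move=> x0 y0; rewrite !floor_natD_eq ?divr_gt0 // !ltr_pdivrMr // !mul1r.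
by split=> -[].
Qed.

Theorem lemma4 (R : realType) (alpha beta : R) (a b : nat -> nat)
    (alpha_gt0 : 0 < alpha) (beta_gt0 : 0 < beta) :
  proper_BCF a b alpha beta <-> appropriate_BCF a b alpha beta.
Proof.
split=> bcf n.
  have [x [y [x0 y0 eqS /(_ isT) proper]]] := bcf n.+1.
  (* By one unfolding of the recursion, [eqS] is already the equation for these tails. *)
  exists ((a n)%:R + y / x), ((b n)%:R + 1 / x).
  by split; rewrite ?ltr_wpDl ?divr_gt0 //; apply/fib_tree_step_floor.
have [x [y [x0 y0 eqn _]]] := bcf n.
exists x, y; split=> //; case: n eqn => // n eqS _.
(* Here [n] is the predecessor of the original index; by uniqueness [x'], [y'] are one step applied
   to [x], [y], so [fl] transfers. *)
have [x' [y' [x'0 y'0 eqn fl]]] := bcf n.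
apply/(fib_tree_step_floor (a n) (b n) x0 y0).
have := eqn; rewrite eqS /= => /fib_tree_sum_inj[]; rewrite ?ltr_wpDl ?divr_gt0 //.
by move=> -> ->.
Qed.
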